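(* Let $G=(V,E)$ be a finite, simple, undirected graph with $n=|V|$ vertices and $m=|E|$ edges, and let $s,t\in V$ with $s$ and $t$ connected in $G$. The procedure LIST described below, started with the call $\mathrm{LIST}(s,s,\pi,G)$ for an $st$-path $\pi$ of $G$, takes $O\big(m + P\,(t_p + n t_q + n t_u)\big)$ time, where $P$ is the number of chordless $st$-paths of $G$, $t_p$ is the cost of choosing any path between two given (connected) vertices of the current graph, $t_q$ is the cost of checking whether two given vertices of the current graph are connected, and $t_u$ is the cost of removing or adding back a given edge of the current graph.
   Context: A path is chordless if the subgraph of $G$ induced by its vertices contains exactly the edges of the path. $N_H(u)$ denotes the neighbourhood of $u$ in the current graph $H$. The procedure $\mathrm{LIST}(\pi_{su}, u, \pi_{ut}, H)$ takes a path $\pi_{su}$ from $s$ to $u$, the current vertex $u$, a $u$–$t$ path $\pi_{ut}$ in $H$, and a current graph $H$ (a graph obtained from $G$ by deleting some vertices with their incident edges; it is modified in place). It works as follows. If $u=t$, output $\pi_{su}$. Otherwise set $S:=\emptyset$ and repeat: let $v$ be the vertex of $N_H(u)$ lying on $\pi_{ut}$ that is closest to $t$ along $\pi_{ut}$; let $\pi_{vt}$ be the subpath of $\pi_{ut}$ from $v$ to $t$; add the pair $(v,\pi_{vt})$ to $S$; delete $v$ and its incident edges from $H$; if $u$ and $t$ are not connected in $H$, leave the loop; otherwise set $\pi_{ut}$ to be any $u$–$t$ path in $H$ and continue. After the loop, for each pair $(v,\pi_{vt})\in S$ in turn: add $v$ and its incident edges back to $H$, call $\mathrm{LIST}(\pi_{su}\cdot(u,v),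 v, \pi_{vt}, H)$, and then delete $v$ and its incident edges from $H$ again. Here $\pi_{su}\cdot(u,v)$ is the path $\pi_{su}$ extended by the edge $(u,v)$.
   Formalization: Before returning, each call adds the vertices of its own S back to H (at cost t_u per edge), since otherwise later sibling calls are ill-defined; the costs t_p, t_q, t_u are taken to be integers at least 1, as elementary steps are charged too. *)

(* Defs.v *)
From mathcomp Require Import all_boot.

Set Implicit Arguments.
Unset Strict Implicit.
Unset Printing Implicit Defensive.

(** A finite simple undirected graph is a symmetric irreflexive [e : rel T] on
    [T : finType]; a graph obtained from it by deleting vertices is given by
    the set [H : {set T}] of the remaining vertices. *)

Section Graph.

Variables (T : finType) (e : rel T).

Definition edge_set : {set {set T}} :=
  [set E : {set T} | [exists x, [exists y, e x y && (E == [set x; y])]]].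

Definition nbrs (H : {set T}) (u : T) : {set T} := [set w in H | e u w].

Definition connected (H : {set T}) (x y : T) : bool :=
  [&& x \in H, y \in H &
      connect [rel a b | [&& a \in H, b \in H & e a b]] x y].

(** A path is the nonempty sequence of its (distinct) vertices. *)
Definition is_path (H : {set T}) (x y : T) (p : seq T) : bool :=
  if p is z :: q then
    [&& z == x, last z q == y, path e z q, uniq p & all (mem H) p]
  else false.

Definition path_edge (p : seq T) (x y : T) : bool :=
  ((x, y) \in zip p (behead p)) || ((y, x) \in zip p (behead p)).

Definition chordless (p : seq T) : bool :=
  all (fun x => all (fun y => e x y == path_edge p x y) p) p.

(** Paths have distinct vertices, so at most [#|T|] of them. *)
Definition num_chordless (s t : T) : nat :=
  #|[set p : #|T|.-bseq T | is_path [set: T] s t p && chordless p]|.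

End Graph.

(** The procedure LIST with its running time.

    Time is counted in elementary steps. Choosing a path costs [tp], a
    connectivity check [tq], and removing or adding back one edge [tu], so
    removing or adding back a vertex costs one step plus [tu] for every edge
    between it and the current graph. Everything else is charged in elementary
    steps. A path is stored together with the position of each vertex on it:
    building this table costs [#|T|] steps for every path chosen. The neighbour
    of [u] nearest to [t] on the path is then found by one scan of [N_H(u)],
    and a suffix of a path is a pointer into the stored path.

    [choose psu u H] is the path selected when the procedure, at the vertex [u]
    with the current prefix [psu] and current graph [H], asks for an arbitrary
    [u]-[t] path of [H]. Distinct calls in a run have distinct prefixes, and [H]
    shrinks during the loop of a call, so no triple [(psu, u, H)] is queried
    twice: ranging over all functions [choose] covers every way of resolving
    the arbitrary choices. *)

Section List.

Variables (T : finType) (e : rel T) (t : T).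
Variable choose : seq T -> T -> {set T} -> seq T.
Variables tp tq tu : nat.

Definition update_cost (H : {set T}) (v : T) : nat :=
  1 + #|nbrs e H v| * tu.

Definition nearest_nbr (H : {set T}) (u : T) (put : seq T) : T :=
  last u [seq w <- put | w \in nbrs e H u].

Definition subpath_from (v : T) (p : seq T) : seq T := drop (index v p) p.

Definition iteration_cost (H : {set T}) (u v : T) : nat :=
  #|nbrs e H u| + 2 + update_cost H v + tq.

(** [list_loop psu u put H S H' c]: started in the graph [H] with the path
    [put], the loop collects the pairs [S] (in this order), stops in the graph
    [H'], and takes time [c]. *)
Inductive list_loop (psu : seq T) (u : T) :
    seq T -> {set T} -> seq (T * seq T) -> {set T} -> nat -> Prop :=
| Loop_exit put H v :
    v = nearest_nbr H u put -> v \in put -> v \in nbrs e H u ->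
    ~~ connected e (H :\ v) u t ->
    list_loop psu u put H [:: (v, subpath_from v put)] (H :\ v)
      (iteration_cost H u v)
| Loop_next put H v S H' c :
    v = nearest_nbr H u put -> v \in put -> v \in nbrs e H u ->
    connected e (H :\ v) u t ->
    list_loop psu u (choose psu u (H :\ v)) (H :\ v) S H' c ->
    list_loop psu u put H ((v, subpath_from v put) :: S) H'
      (iteration_cost H u v + tp + #|T| + c).

(** Before returning, a call puts the vertices of its own [S] back, undoing its
    deletions in reverse order, so that the caller finds its graph unchanged. *)
Fixpoint restore (S : seq (T * seq T)) (H : {set T}) : {set T} :=
  if S is x :: S' then x.1 |: restore S' H else H.

Fixpoint restore_cost (S : seq (T * seq T)) (H : {set T}) : nat :=
  if S is x :: S' then restore_cost S' H + update_cost (restore S' H) x.1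
  else 0.

(** [list_run psu u put H H' out c]: the call LIST(psu, u, put, H) terminates
    with the graph [H'], having output the paths [out] in time [c].
    [list_each psu S H H' out c] is the pass over the pairs in [S]. *)
Inductive list_run :
    seq T -> T -> seq T -> {set T} -> {set T} -> seq (seq T) -> nat -> Prop :=
| Run_output psu put H :
    list_run psu t put H H [:: psu] (1 + size psu)
| Run_branch psu u put H S H1 H2 out c1 c2 :
    u <> t ->
    list_loop psu u put H S H1 c1 ->
    list_each psu S H1 H2 out c2 ->
    list_run psu u put H (restore S H2) out
      (1 + c1 + c2 + restore_cost S H2)
with list_each :
    seq T -> seq (T * seq T) -> {set T} -> {set T} -> seq (seq T) -> nat ->
    Prop :=
| Each_nil psu H :
    list_each psu [::] H H [::] 0
| Each_cons psu v pvt S H H1 H2 out1 out2 c1 c2 :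
    list_run (rcons psu v) v pvt (v |: H) H1 out1 c1 ->
    list_each psu S (H1 :\ v) H2 out2 c2 ->
    list_each psu ((v, pvt) :: S) H H2 (out1 ++ out2)
      (1 + update_cost H v + c1 + update_cost H1 v + c2).

End List.

(** Loading the graph, and the table of positions of the initial path. *)
Definition setup_cost (T : finType) (e : rel T) : nat :=
  #|T| + #|edge_set e| + #|T|.

(* Main.v *)
Require Import Defs.
From mathcomp Require Import all_boot.
From mathcomp Require Import zify.

(** For a call at [u] in the graph [H], let [A] be the component of [t] in
    [H :\ u]. When the loop of the call ends, [t] is cut off from [u], so for a
    child call at [v] the corresponding component [B] lies in [A], avoids [v],
    and contains no neighbour of [u]. Hence outputs have no chord: the vertices
    after [v] lie in [B], so they are not adjacent to [u]. As siblings branch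
    to distinct vertices, there are at most [P] leaves in the recursion tree.

    A call with [k] children chooses [k - 1] paths, and the numbers [k - 1] sum
    to the number of leaves minus one; each of them also pays for one table of
    positions and one scan of [N(u)]. What remains is charged to the branches
    from the root to the leaves. One connectivity check per edge of a branch
    gives [n tq], since [A] shrinks strictly. The updates at [v] cost [tu] times
    the degree of [v] in [H], at most [#|A :&: N(v)| + 1]; along a branch these
    sum to [O(n)], because [#|A| + #|A :\: N(u)|] drops by at least
    [#|A :&: N(v)|] from the call at [u] to the call at [v]. *)

Set Implicit Arguments.
Unset Strict Implicit.
Unset Printing Implicit Defensive.

Lemma mem_zip (A B : eqType) (s : seq A) (r : seq B) x y :
  (x, y) \in zip s r -> x \in s /\ y \in r.
Proof.
elim: s r => [|a s IHs] [|b r] //=; rewrite !in_cons xpair_eqE.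
by case/orP=> [/andP[-> ->]//|/IHs[-> ->]]; rewrite !orbT.
Qed.

(** * Connectivity and paths after vertex deletions *)

Section Connectivity.

Variables (T : finType) (e : rel T).
Implicit Types (G H : {set T}) (x y z : T) (p q : seq T).

Lemma connected_refl G x : x \in G -> connected e G x x.
Proof. by move=> xG; rewrite /connected xG connect0. Qed.

Lemma connected_step G x y z :
  x \in G -> e x y -> connected e G y z -> connected e G x z.
Proof.
move=> xG exy /and3P[yG zG cyz]; rewrite /connected xG zG /=.
by apply: connect_trans cyz; apply: connect1; rewrite /= xG yG.
Qed.

Lemma connected_ind G z (P : T -> Prop) :
  P z ->
  (forall x y, x \in G -> e x y -> connected e G y z -> P y -> P x) ->
  forall x, connected e G x z -> P x.
Proof.
move=> Pz PS x /and3P[xG zG /connectP[p]].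
elim: p x xG => [|y p IHp] x xG /=; first by move=> _ <-.
case/andP=> /and3P[_ yG exy] pth lst.
apply: (PS x y) => //; last exact: IHp lst.
by rewrite /connected yG zG; apply/connectP; exists p.
Qed.

Lemma connected_sub G H x y :
  G \subset H -> connected e G x y -> connected e H x y.
Proof.
move=> /subsetP GH cxy; have yH : y \in H by case/and3P: cxy => _ /GH.
elim/connected_ind: x / cxy => [|x z xG exz _]; first exact: connected_refl.
by apply: connected_step => //; apply: GH.
Qed.

(** A walk from [x] to [z] through [y] would connect [y] to [z], so every such walk avoids [y]. *)
Lemma connected_setD1 G x y z :
  connected e G x z -> ~~ connected e G y z -> connected e (G :\ y) x z.
Proof.
move=> cxz ncy; have zG : z \in G by case/and3P: cxz.
elim/connected_ind: x / cxz => [|x w xG exw cw].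
  apply: connected_refl; rewrite !inE zG andbT.
  by apply: contraNneq ncy => <-; apply: connected_refl.
apply: connected_step => //; rewrite !inE xG andbT.
by apply: contraNneq ncy => <-; apply: connected_step cw.
Qed.

Lemma is_path_connected G x y p : is_path e G x y p -> connected e G x y.
Proof.
case: p => [|z q] //= /and5P[/eqP-> /eqP <- pth _ /andP[xG qG]].
elim: q x xG pth qG {z} => [|z q IHq] x xG /=.
  by move=> _ _; apply: connected_refl.
move=> /andP[exz pth] /andP[zG qG]; apply: connected_step exz _ => //.
exact: IHq.
Qed.

Lemma is_path_suffix G x y z p q :
  is_path e G x y (p ++ z :: q) -> is_path e G z y (z :: q).
Proof.
case: p => [|w p] /=.
  by case/and5P=> _ -> -> -> ->; rewrite eqxx.
case/and5P=> _ + + /andP[_ +] /andP[_].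
rewrite last_cat cat_path cat_uniq all_cat /= eqxx.
by move=> -> /and3P[_ _ ->] /and4P[_ _ -> ->] /and3P[_ -> ->].
Qed.

Lemma is_path_mem G x y p : is_path e G x y p -> {in p, forall z, z \in G}.
Proof. by case: p => [|z q] // /and5P[_ _ _ _ /allP]. Qed.

Lemma is_path_sub G H x y p :
  is_path e G x y p -> {in p, forall z, z \in H} -> is_path e H x y p.
Proof.
case: p => [|z q] // /and5P[h1 h2 h3 h4 _] pH; apply/and5P; split=> //.
exact/allP.
Qed.

Lemma nbrsS G H x : G \subset H -> nbrs e G x \subset nbrs e H x.
Proof.
by move=> /subsetP GH; apply/subsetP=> z; rewrite !inE => /andP[/GH-> ->].
Qed.

Lemma update_costS tu G H x :
  G \subset H -> update_cost e tu G x <= update_cost e tu H x.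
Proof.
by move=> GH; rewrite leq_add2l leq_mul2r subset_leq_card ?orbT ?nbrsS.
Qed.

Lemma path_edge_cons x y a b p :
  x != a -> x != b -> path_edge (x :: y :: p) a b = path_edge (y :: p) a b.
Proof.
move=> xa xb; rewrite /path_edge /= !in_cons !xpair_eqE.
by rewrite !(eq_sym _ x) (negPf xa) (negPf xb).
Qed.

End Connectivity.

(** * The neighbour to branch to *)

Section Nearest.

Variables (T : finType) (e : rel T).
Hypothesis e_irr : irreflexive e.
Variables (t u : T).
Hypothesis ut : u <> t.

(** Since [u <> t], the second vertex of [p] is a neighbour of [u]. So the filtered list is
    nonempty, and past its last entry [p] meets no neighbour of [u]. *)
Lemma nearest_nbrP H p v :
  is_path e H u t p -> v = nearest_nbr e H u p ->
  [/\ v \in p, v \in nbrs e H u & exists2 q, subpath_from v p = v :: q &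
      [/\ is_path e H v t (v :: q), u \notin v :: q &
          {in q, forall w, w \notin nbrs e H u}]].
Proof.
move=> pth vE; have : v \in [seq w <- p | w \in nbrs e H u].
  rewrite vE /nearest_nbr; case: p pth {vE} => [|z q] //=.
  case/and5P=> /eqP-> /eqP lst pth _ /andP[_ qH].
  case: q lst pth qH => [/ut|w q] //= _ /andP[euw _] /andP[wH _].
  rewrite [w \in _]inE [w \in H]wH euw /=.
  by case: ifP => _ /=; rewrite ?[_ \in u :: _]in_cons mem_last ?orbT.
rewrite mem_filter => /andP[vN vp]; split=> //.
have uv : u != v.
  by apply: contraTneq vN => <-; rewrite inE e_irr andbF.
have pU : uniq p by case: p pth {vE vp} => [|z q] // /and5P[].
case/splitPr: vp pth vE pU => p1 p2 pth vE.
rewrite cat_uniq /= => /and4P[_ /norP[vp1 _] vp2 _].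
have suf := is_path_suffix pth.
exists p2.
  by rewrite /subpath_from index_cat (negPf vp1) /= eqxx addn0 drop_size_cat.
split=> //.
  case: p1 vp1 pth {vE} => [|z p1] vp1 /=.
    by case/andP=> /eqP vu; rewrite vu eqxx in uv.
  case/and5P=> /eqP-> _ _ + _.
  by rewrite mem_cat => /andP[/norP[]].
move=> w wp2; apply/negP => wN; move: vE; rewrite /nearest_nbr.
rewrite filter_cat last_cat /= vN /=.
have : w \in [seq w <- p2 | w \in nbrs e H u] by rewrite mem_filter wN.
case E: [seq _ <- _ | _] => [|a l] //= _ vE.
have : v \in a :: l by rewrite vE mem_last.
by rewrite -E mem_filter (negPf vp2) andbF.
Qed.

End Nearest.

(** * The loop that collects the branches *)

Section Loop.

Variables (T : finType) (e : rel T).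
Hypothesis e_irr : irreflexive e.
Variables (t : T) (choose : seq T -> T -> {set T} -> seq T).
Hypothesis choose_path : forall psu u H,
  connected e H u t -> is_path e H u t (choose psu u H).
Variables tp tq tu : nat.
Implicit Types (H G : {set T}) (S : seq (T * seq T)).

Let loop := list_loop e t choose tp tq tu.

(** Every iteration deletes a vertex of [H], so the loop terminates. *)
Lemma list_loop_exists psu u put H :
  u <> t -> is_path e H u t put -> exists S H' c, loop psu u put H S H' c.
Proof.
move=> ut; have [n] := ubnP #|H|; elim: n put H => // n IHn put H ltHn pth.
have [vp vN _] := nearest_nbrP e_irr ut pth erefl.
set v := nearest_nbr _ _ _ _ in vp vN.
have [cv|ncv] := boolP (connected e (H :\ v) u t); last first.
  by do 3!eexists; apply: Loop_exit ncv.
have [||S [H' [c run]]] := IHn (choose psu u (H :\ v)) (H :\ v).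
- have vH : v \in H by case/setIdP: vN.
  by rewrite (cardsD1 v H) vH in ltHn.
- exact: choose_path.
by do 3!eexists; apply: Loop_next run.
Qed.

Lemma restore_sub S H : H \subset restore S H.
Proof. by elim: S => //= x S IHS; rewrite (subset_trans IHS) ?subsetUr. Qed.

(** The suffix stored with a pair avoids [u] and all vertices deleted later, so it serves the child
    call unchanged. Of [k] iterations only [k - 1] choose a path; with one more path charge added on
    the left, every pair carries one. Its two [#|T|] are the table of positions and the next
    neighbour scan. *)
Lemma list_loopP psu u put H S H' c :
  u <> t -> is_path e H u t put -> loop psu u put H S H' c ->
  [/\ restore S H' = H, uniq (unzip1 S), ~~ connected e H' u t & u \in H'] /\
  {in S, forall x, [/\ x.1 \in nbrs e H u, x.1 \notin H' &
                       is_path e ((x.1 |: H') :\ u) x.1 t x.2]} /\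
  [/\ S != [::], H :\: H' \subset nbrs e H u &
      c + (tp + #|T| + #|T|) <= #|nbrs e H u| +
        \sum_(x <- S) (2 + update_cost e tu H x.1 + tq
                       + (tp + #|T| + #|T|))].
Proof.
move=> ut + run.
(* The vertices after [v] on the path are not adjacent to [u], so they are not
   deleted by the rest of the loop. *)
have sub_path G G' v q : G' \subset G -> v \in G -> e u v ->
    G :\: (v |: G') \subset nbrs e G u ->
    is_path e G v t (v :: q) -> u \notin v :: q ->
    {in q, forall w, w \notin nbrs e G u} ->
    is_path e ((v |: G') :\ u) v t (v :: q).
  move=> G'G vG euv /subsetP sN pth uq qN; apply: (is_path_sub pth) => w wq.
  have wu : w != u by apply: contraNneq uq => <-.
  rewrite !inE wu /=; have [//|wv /=] := eqVneq w v.
  have {}wq : w \in q by rewrite inE (negPf wv) in wq.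
  apply: contraR (qN _ wq) => wG'; apply: sN; rewrite !inE (negPf wv) wG' /=.
  by apply: (is_path_mem pth); rewrite inE wq orbT.
elim: run => {put H S H' c} [put H v vE vp vN nc|
                             put H v S H' c vE vp vN cv run IH] pth.
  have [_ _ [q -> [pq uq qN]]] := nearest_nbrP e_irr ut pth vE.
  case/setIdP: (vN) => vH euv; have uv : u != v.
    by apply: contraTneq euv => ->; rewrite e_irr.
  have uH : u \in H by case/and3P: (is_path_connected pth).
  split; first by split; rewrite //= ?setD1K // !inE uv.
  split.
    move=> x; rewrite inE => /eqP-> /=; split=> //; first by rewrite !inE eqxx.
    apply: (sub_path H) => //; first exact: subD1set.
    by rewrite setD1K // setDv sub0set.
  split=> //.
    apply/subsetP=> w; rewrite !inE negb_and negbK.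
    by case/andP=> /orP[/eqP->|/negPf->//] _; rewrite vH.
  rewrite big_seq1 /iteration_cost /=.
  by move: (update_cost _ _ _ _) #|nbrs _ _ _| #|T|; clear; lia.
have [_ _ [q -> [pq uq qN]]] := nearest_nbrP e_irr ut pth vE.
case/setIdP: (vN) => vH euv; have uv : u != v.
  by apply: contraTneq euv => ->; rewrite e_irr.
have [[rS uS ncH' uH'] [inS [S0 HH' cS]]] := IH (choose_path _ cv).
have HvH : nbrs e (H :\ v) u \subset nbrs e H u by rewrite nbrsS ?subD1set.
have H'H : H' \subset H :\ v by rewrite -rS restore_sub.
split.
  split=> //=; first by rewrite rS setD1K.
  rewrite uS andbT; apply/mapP => -[x /inS[]]; rewrite !inE => + _ _ vx.
  by rewrite -vx eqxx.
split.
  move=> x; rewrite inE => /predU1P[->|/inS[xN xH' px]] /=; last first.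
    by split=> //; apply: (subsetP HvH).
  split=> //.
    by apply/negP=> /(subsetP H'H); rewrite !inE eqxx.
  apply: (sub_path H) => //; first exact: subset_trans H'H (subD1set _ _).
  by rewrite -setDDl (subset_trans HH').
split=> //.
  apply/subsetP=> w; rewrite inE => /andP[wH' wH].
  have [->//|wv] := eqVneq w v.
  by apply/(subsetP HvH)/(subsetP HH'); rewrite !inE wH' wv.
rewrite big_cons /iteration_cost /=.
have le1 : #|nbrs e (H :\ v) u| <= #|T| by apply: max_card.
have le2 : \sum_(x <- S) (2 + update_cost e tu (H :\ v) x.1 + tq
     + (tp + #|T| + #|T|)) <=
   \sum_(x <- S) (2 + update_cost e tu H x.1 + tq + (tp + #|T| + #|T|)).
  by apply: leq_sum => x _; rewrite !leq_add2r leq_add2l update_costS ?subD1set.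
move: (leq_trans cS (leq_add le1 le2)).
move: (\sum_(x <- S) _) (update_cost _ _ _ _) #|nbrs e H u| => A U N.
by move: #|T| => n; clear; lia.
Qed.

Lemma restore_cost_le S H G :
  restore S H \subset G ->
  restore_cost e tu S H <= \sum_(x <- S) update_cost e tu G x.1.
Proof.
elim: S => [|x S IHS] /=; first by rewrite big_nil.
rewrite subUset => /andP[_ sG]; rewrite big_cons addnC leq_add ?IHS //.
exact: update_costS.
Qed.

End Loop.

(** * Correctness and cost of the recursion *)

Section Run.

Variables (T : finType) (e : rel T).
Hypotheses (e_sym : symmetric e) (e_irr : irreflexive e).
Variables (t : T) (choose : seq T -> T -> {set T} -> seq T).
Hypothesis choose_path : forall psu u H,
  connected e H u t -> is_path e H u t (choose psu u H).
Variables tp tq tu : nat.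
Hypothesis tu_gt0 : 0 < tu.
Implicit Types (H G : {set T}) (S : seq (T * seq T)).

Let run := list_run e t choose tp tq tu.
Let each := list_each e t choose tp tq tu.

Lemma list_run_inv psu u put H H' out c :
  run psu u put H H' out c ->
  [/\ u = t, H' = H, out = [:: psu] & c = 1 + size psu] \/
  u <> t /\ exists S H1 H2 c1 c2,
    [/\ list_loop e t choose tp tq tu psu u put H S H1 c1,
        each psu S H1 H2 out c2, H' = restore S H2
      & c = 1 + c1 + c2 + restore_cost e tu S H2].
Proof.
case=> [{}psu {}put {}H|{}psu {}u {}put {}H S H1 H2 {}out c1 c2 ut lp ea].
  by left.
by right; split=> //; exists S, H1, H2, c1, c2.
Qed.

Lemma list_each_inv psu S H H' out c :
  each psu S H H' out c ->
  match S with
  | [::] => [/\ H' = H, out = [::] & c = 0]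
  | (v, pvt) :: S' => exists H1 out1 out2 c1 c2,
      [/\ run (rcons psu v) v pvt (v |: H) H1 out1 c1,
          each psu S' (H1 :\ v) H' out2 c2, out = out1 ++ out2
        & c = 1 + update_cost e tu H v + c1 + update_cost e tu H1 v + c2]
  end.
Proof.
case=> [{}psu {}H|{}psu v pvt {}S {}H H1 H2 out1 out2 c1 c2 r1 r2] //.
by exists H1, out1, out2, c1, c2.
Qed.

(** For a call at [u] in the graph [H], the relevant instance is
    [to_target (H :\ u)]: [u] itself stays in [H] during its child calls. *)
Definition to_target G : {set T} := [set w | connected e G w t].

(** The list [q] omits [u], but chordlessness includes it, so a chord from [u] is excluded too. *)
Definition continuation u (A : {set T}) (q : seq T) : Prop :=
  [/\ path e u q, last u q = t, uniq (u :: q), chordless e (u :: q)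
    & {in q, forall w, w \in A}].

(** Only [v] among [v :: q] is adjacent to [u], because the rest lies in [B]; hence prepending [u]
    creates no chord. *)
Lemma continuation_cons u v (A B : {set T}) q :
  e u v -> u \notin A -> v \in A -> B \subset A ->
  {in B, forall w, ~~ e u w} ->
  continuation v B q -> continuation u A (v :: q).
Proof.
move=> euv uA vA /subsetP BA uB [pth lst unq chd qB].
have qA : {in v :: q, forall w, w \in A}.
  by move=> w; rewrite inE => /predU1P[->//|/qB/BA].
have uq : {in v :: q, forall w, u != w}.
  by move=> w /qA wA; apply: contraNneq uA => ->.
have uvq w : w \in v :: q -> e u w = (w == v).
  rewrite inE => /predU1P[->|wq]; first by rewrite euv eqxx.
  rewrite (negPf (uB w (qB w wq))); apply/esym/negP=> /eqP wv.
  by case/andP: unq; rewrite -wv wq.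
have peu w : w \in v :: q -> path_edge [:: u, v & q] u w = (w == v).
  move=> wq; rewrite /path_edge /= !in_cons !xpair_eqE eqxx /=.
  have nz z : (u, z) \in zip (v :: q) q = false.
    by apply/negP=> /mem_zip [/uq]; rewrite eqxx.
  have nz' z : (z, u) \in zip (v :: q) q = false.
    apply/negP=> /mem_zip [_ uq']; have := uq u.
    by rewrite inE uq' orbT eqxx => /(_ isT).
  by rewrite nz nz' (negPf (uq v _)) ?mem_head // andbF !orbF.
have pes x y : path_edge [:: u, v & q] x y = path_edge [:: u, v & q] y x.
  by rewrite /path_edge orbC.
split=> //.
- by rewrite /= euv.
- by rewrite cons_uniq unq andbT; apply/negP=> /uq; rewrite eqxx.
apply/allP=> x xuvq; apply/allP=> y yuvq; apply/eqP.
move: xuvq yuvq; rewrite [x \in _]in_cons [y \in _]in_cons.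
case/predU1P=> [->|xq] /predU1P[->|yq].
- rewrite e_irr /path_edge /= !in_cons !xpair_eqE (negPf (uq v _)) ?mem_head //.
  rewrite andbF /= orbb; apply/esym/negP=> /mem_zip [/uq].
  by rewrite eqxx.
- by rewrite uvq ?peu.
- by rewrite e_sym pes uvq ?peu.
- rewrite path_edge_cons ?uq //.
  by move/allP/(_ x xq)/allP/(_ y yq)/eqP: chd.
Qed.

(** Pays, per leaf below the call at [u], for everything but the chosen paths:
    [#|T|] for the output, the second term for the constant costs and the
    connectivity check of each later edge, the third for the vertex updates. *)
Definition potential H u : nat :=
  let A := to_target (H :\ u) in
  #|T| + (9 + tq + 4 * tu) * #|A| + 5 * tu * (#|A| + #|A :\: nbrs e H u|).

(** The graph on the left is [H'], where [u] is cut off from [t]; a walk to [t] there meets neither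
    [u] nor a neighbour of [u]. *)
Lemma to_target_child H H' u v :
  u \in H' -> H' \subset H -> ~~ connected e H' u t -> v \notin H' ->
  to_target ((v |: H') :\ v) \subset
    to_target (H :\ u) :\: (v |: nbrs e H u).
Proof.
move=> uH' H'H nc vH'; apply/subsetP=> w; rewrite !inE setU1K // => cw.
rewrite (connected_sub _ (connected_setD1 cw nc)) ?setSD // andbT negb_or.
apply/andP; split; first by apply: contraNneq vH' => <-; case/and3P: cw.
rewrite negb_and; apply/orP; right; apply: contra nc => euw.
exact: connected_step cw.
Qed.

(** Chosen paths apart, the left side is the charge of a child: four updates at [v] (loop, before
    and after its call, restoration), a connectivity check, constants, and the child's own charge
    per leaf. *)
Lemma potential_child H H' u v :
  u \in H' -> H' \subset H -> ~~ connected e H' u t ->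
  v \in nbrs e H u -> v \notin H' -> v \in to_target (H :\ u) ->
  7 + tq + 4 * (tu * #|nbrs e H v|)
    + (1 + #|nbrs e (v |: H') v| + potential (v |: H') v) <= potential H u.
Proof.
move=> uH' H'H nc vN vH' vA.
have /setIdP[vH euv] := vN.
have H2H : v |: H' \subset H by rewrite subUset sub1set vH.
have := to_target_child uH' H'H nc vH'.
rewrite /potential; set A := to_target (H :\ u).
set B := to_target _ => BA.
have cB1 : #|B| < #|A|.
  rewrite (cardsD1 v A) vA ltnS subset_leq_card //.
  by apply: subset_trans BA _; rewrite setDS // subsetUl.
(* The bounds are crossed: [#|B|] against the second summand of the parent, and below the second
   summand of the child against [#|A|]. *)
have cB2 : #|B| <= #|A :\: nbrs e H u|.
  by rewrite subset_leq_card // (subset_trans BA) // setDS ?subsetUr.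
have cN : #|nbrs e (v |: H') v| <= #|nbrs e H v|.
  by rewrite subset_leq_card ?nbrsS.
have NA : nbrs e H v \subset u |: (A :&: [set w | e v w]).
  apply/subsetP=> w; rewrite !inE => /andP[wH evw].
  have [//|wu] := eqVneq w u; rewrite evw andbT /=.
  apply: (@connected_step _ _ _ w v); rewrite ?inE ?wu 1?e_sym //.
  by move: vA; rewrite inE.
have cNA : #|nbrs e H v| <= 1 + #|A :&: [set w | e v w]|.
  by apply: leq_trans (subset_leq_card NA) _; rewrite cardsU1 leq_add2r leq_b1.
have BN : B :\: nbrs e (v |: H') v \subset A :\: [set w | e v w].
  apply/subsetP=> w; rewrite [w \in B :\: _]inE => /andP[wN wB].
  have := subsetP BA w wB; rewrite [w \in _ :\: (_ |: _)]inE => /andP[_ wA].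
  rewrite inE wA andbT inE; apply: contra wN => evw; rewrite inE evw andbT.
  move: wB; rewrite inE => /and3P[+ _ _].
  by case/setD1P.
have cBN : #|A :&: [set w | e v w]| + #|B :\: nbrs e (v |: H') v| <= #|A|.
  by rewrite -(cardsID [set w | e v w] A) leq_add2l subset_leq_card.
move: cB1 cB2 cN cNA cBN.
move: #|B| #|A| #|A :\: nbrs e H u| #|nbrs e (v |: H') v| #|nbrs e H v|.
move: #|_ :&: _| #|B :\: _| #|T| => a b' n b a0 a1 k m.
move: tu_gt0; clear => tu_gt0 ltb leb km ma leb'.
(* The drop of [#|A|] by one pays [tq], [4 * tu] and 9. The drop of the last term, at least
   [5 * tu * a], pays the rest of the four updates and, as [tu] is positive, the scan. *)
nia.
Qed.

(** [g] adds to a child its share of the caller's costs outside this pass. Outputs of different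
    children differ right after [psu], hence are distinct. *)
Lemma list_eachP psu S H B (g : T -> nat) (A : T -> {set T}) :
  uniq (unzip1 S) ->
  {in S, forall x, x.1 \notin H /\
    (exists H' out c, run (rcons psu x.1) x.1 x.2 (x.1 |: H) H' out c) /\
    forall H' out c, run (rcons psu x.1) x.1 x.2 (x.1 |: H) H' out c ->
      [/\ H' = x.1 |: H, uniq out,
          {in out, forall p, exists2 q, p = rcons psu x.1 ++ q &
             continuation x.1 (A x.1) q} &
          1 + update_cost e tu H x.1 + c + update_cost e tu (x.1 |: H) x.1
            + g x.1 <= size out * B]} ->
  (exists H' out c, each psu S H H' out c) /\
  forall H' out c, each psu S H H' out c ->
    [/\ H' = H, uniq out,
        {in out, forall p, exists v q,
           [/\ v \in unzip1 S, p = psu ++ v :: q & continuation v (A v) q]} &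
        c + \sum_(x <- S) g x.1 <= size out * B].
Proof.
elim: S => [|[v pvt] S IHS].
  move=> _ _; split; first by do 3!eexists; apply: Each_nil.
  move=> H' out c /list_each_inv[-> -> ->]; split=> //.
  by rewrite big_nil.
move=> /= /andP[vS uS] hS.
have [vH [[H1 [out1 [c1 r1]]] rP]] := hS (v, pvt) (mem_head _ _).
have [|[H2 [out2 [c2 r2]]] eP] := IHS uS.
  by move=> x xS; apply: hS; rewrite inE xS orbT.
split.
  have [/= eH1 _ _ _] := rP _ _ _ r1.
  do 3!eexists; apply: (Each_cons r1); rewrite eH1 setU1K //; exact: r2.
move=> H' out c /list_each_inv {H1 out1 c1 r1 H2 out2 c2 r2}.
case=> H1 [out1 [out2 [c1 [c2 [r1 r2 -> ->]]]]].
have /= [eH1 u1 o1 b1] := rP _ _ _ r1.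
rewrite eH1 setU1K // in r2 *.
have [-> u2 o2 b2] := eP _ _ _ r2.
split=> //.
- rewrite cat_uniq u1 u2 andbT; apply/hasPn=> p /o2[w [q [wS -> _]]].
  apply/negP=> /o1[q' /eqP + _]; rewrite cat_rcons eqseq_cat // eqxx /=.
  by case/eqP=> wv _; rewrite -wv wS in vS.
- move=> p; rewrite mem_cat => /orP[/o1[q -> cq]|/o2[w [q [wS -> cq]]]].
    by exists v, q; rewrite mem_head cat_rcons.
  by exists w, q; rewrite inE wS orbT.
rewrite big_cons size_cat mulnDl /=; apply: leq_trans (leq_add b1 b2).
by rewrite leq_eqVlt; apply/orP; left; apply/eqP; lia.
Qed.

(** The extra [tp + #|T| + #|T|] on the left turns the sum of [k - 1] over the
    calls into a bound that is additive over the leaves. *)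
Lemma list_runP psu u put H :
  is_path e H u t put -> size psu + #|to_target (H :\ u)| <= #|T| ->
  (exists H' out c, run psu u put H H' out c) /\
  forall H' out c, run psu u put H H' out c ->
    [/\ H' = H, uniq out,
        {in out, forall p, exists2 q, p = psu ++ q &
           continuation u (to_target (H :\ u)) q} &
        c + (tp + #|T| + #|T|) <= size out *
          (1 + #|nbrs e H u| + potential H u + (tp + #|T| + #|T|))].
Proof.
have [n] := ubnP #|to_target (H :\ u)|.
elim: n psu u put H => // n IHn psu u put H; rewrite ltnS => leAn pth psuA.
have [ut|/eqP ut] := eqVneq u t.
  rewrite {}ut in leAn pth psuA *; split.
    by do 3!eexists; apply: Run_output.
  move=> H' out c /list_run_inv[[_ -> -> ->]|[]//]; split=> //.
    move=> p; rewrite inE => /eqP->; exists [::]; rewrite ?cats0 //; split=> //.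
    by rewrite /chordless /= e_irr.
  (* The output has length at most [#|T|], the first term of the potential. *)
  rewrite mul1n leq_add2r -addnA leq_add2l /potential.
  by move: psuA; clear; lia.
set X := tp + #|T| + #|T|.
(* Shared by the existence of a run and the bound on every run. *)
have runS S H1 c1 :
    list_loop e t choose tp tq tu psu u put H S H1 c1 ->
    [/\ restore S H1 = H, S != [::],
        c1 + X <= #|nbrs e H u| +
          \sum_(x <- S) (2 + update_cost e tu H x.1 + tq + X) &
    (exists H2 out c, each psu S H1 H2 out c) /\
    forall H2 out c, each psu S H1 H2 out c ->
      [/\ H2 = H1, uniq out,
          {in out, forall p, exists2 q, p = psu ++ q &
             continuation u (to_target (H :\ u)) q} &
          c + \sum_(x <- S) (2 + 2 * update_cost e tu H x.1 + tq + X)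
            <= size out * (potential H u + X)]].
  case/(list_loopP e_irr choose_path ut pth).
  case=> rS uS nc uH1 [inS [S0 HH1 c1S]].
  have H1H : H1 \subset H by rewrite -rS restore_sub.
  have vA x : x \in S -> x.1 \in to_target (H :\ u).
    case/inS=> xN _ /is_path_connected cx; rewrite inE.
    apply: connected_sub cx; rewrite setSD // subUset sub1set H1H andbT.
    by case/setIdP: xN.
  (* The share of a pair is its loop charge plus one restoring update; its [X] is the extra term on
     the left of the induction hypothesis. *)
  have [x xS|exS eachS] := @list_eachP psu S H1 (potential H u + X)
      (fun v => 2 + 2 * update_cost e tu H v + tq + X)
      (fun v => to_target ((v |: H1) :\ v)) uS.
    have [xN xH1 px] := inS x xS; split=> //.
    have := to_target_child uH1 H1H nc xH1.
    have := potential_child uH1 H1H nc xN xH1 (vA x xS).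
    set v := x.1 in xN xH1 px * => pot sub.
    have ltA : #|to_target ((v |: H1) :\ v)| < #|to_target (H :\ u)|.
      rewrite (cardsD1 v (to_target (H :\ u))) vA // ltnS subset_leq_card //.
      by apply: subset_trans sub _; rewrite setDS ?subsetUl.
    have [|||exv runv] := IHn (rcons psu v) v x.2 (v |: H1).
    - exact: leq_trans ltA leAn.
    - by apply: (is_path_sub px) => w /(is_path_mem px)/setD1P[].
    (* The prefix grows by one vertex while the component of [t] loses at least one. *)
    - by rewrite size_rcons addSnnS; apply: leq_trans psuA; rewrite leq_add2l.
    split=> // H' out c /runv[-> uo io bo]; split=> //.
    have vH : v |: H1 \subset H.
      by rewrite subUset sub1set H1H andbT; case/setIdP: xN.
    have u1 := update_costS e tu v H1H.
    have u2 := update_costS e tu v vH.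
    have T0 : 0 < #|T| by apply/card_gt0P; exists v.
    (* A positive cost bounded by a multiple of [size out] forces an output, so costs paid once per
       child fit on its leaves. *)
    have so : 0 < size out.
      by move: bo T0; case: (size out) => //; rewrite mul0n; clear; lia.
    have potX := leq_add pot (leqnn X).
    have := leq_mul (leqnn (size out)) potX; apply: leq_trans.
    rewrite -[7 + tq + _ + _ + X]addnA mulnDr.
    apply: leq_trans (leq_add (leq_pmull _ so) bo).
    move: u1 u2; rewrite [update_cost e tu H v]/update_cost mulnC -/X.
    move: (update_cost _ _ _ _) (update_cost _ _ _ _) (tu * _) (X).
    by clear; lia.
  split=> //; split=> // H2 out c /eachS[-> uo io bo]; split=> //.
  move=> p /io[v [q [vS -> cq]]]; exists (v :: q) => //.
  case/mapP: vS cq => x xS -> cq.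
  have [xN xH1 px] := inS x xS.
  have sub := to_target_child uH1 H1H nc xH1.
  apply: continuation_cons cq.
  - by case/setIdP: xN.
  - by rewrite inE; apply/negP=> /and3P[]; rewrite !inE eqxx.
  - exact: vA.
  - by apply: subset_trans sub (subsetDl _ _).
  move=> w /(subsetP sub); rewrite !inE negb_or negb_and.
  case/andP=> /andP[_ h] cw.
  by case/and3P: cw; rewrite !inE => /andP[_ wH] _ _; rewrite wH in h.
split.
  have [S [H1 [c1 lp]]] :=
    list_loop_exists e_irr choose_path tp tq tu psu ut pth.
  have [_ _ _ [[H2 [out [c ea]]] _]] := runS _ _ _ lp.
  by do 3!eexists; apply: (Run_branch ut lp ea).
move=> H' out c /list_run_inv[[]//|[_ [S [H1 [H2 [c1 [c2 [lp ea -> ->]]]]]]]].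
have [rS S0 lpc [_ /(_ _ _ _ ea)[eH2 uo io bo]]] := runS _ _ _ lp.
rewrite {}eH2 in ea *; split=> //.
have := restore_cost_le e tu (S := S) (H := H1) (G := H).
rewrite rS => /(_ (subxx _)) rc.
have L0 : 0 < size out.
  move: bo; case: (size out) => //; rewrite mul0n leqn0 addn_eq0.
  by case: (S) S0 => // x S' _; rewrite big_cons !addn_eq0 andbF.
(* The call itself and its first scan use [1 + #|nbrs e H u|]; the rest goes to the loop, the pass
   and the restoration. *)
apply: (@leq_trans (size out * (1 + #|nbrs e H u|)
                    + size out * (potential H u + X))); last first.
  by rewrite -mulnDr addnA.
apply: leq_trans (leq_add (leq_pmull _ L0) bo).
have := leq_add lpc rc; rewrite -[leqRHS]addnA -big_split /=.
rewrite (eq_bigr (fun x => 2 + 2 * update_cost e tu H x.1 + tq + X)) /=.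
  move: #|nbrs _ _ _| (X) (restore_cost _ _ _ _) (\sum_(x <- S) _).
  by clear; lia.
by move=> x _; move: (update_cost _ _ _ _) (X); clear; lia.
Qed.

End Run.

(** * The bound for the initial call *)

Theorem theorem2 :
  exists C : nat,
  forall (T : finType) (e : rel T) (s t : T) (pi : seq T)
         (choose : seq T -> T -> {set T} -> seq T) (tp tq tu : nat),
    symmetric e -> irreflexive e ->
    connected e [set: T] s t ->
    is_path e [set: T] s t pi ->
    (forall (psu : seq T) (u : T) (H : {set T}),
        connected e H u t -> is_path e H u t (choose psu u H)) ->
    0 < tp -> 0 < tq -> 0 < tu ->
    (exists (H' : {set T}) (out : seq (seq T)) (c : nat),
        list_run e t choose tp tq tu [:: s] s pi [set: T] H' out c) /\
    (forall (H' : {set T}) (out : seq (seq T)) (c : nat),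
        list_run e t choose tp tq tu [:: s] s pi [set: T] H' out c ->
        setup_cost e + c <=
        C * (#|edge_set e|
             + num_chordless e s t * (tp + #|T| * tq + #|T| * tu))).
Proof.
(* With [1 <= #|T|] and [1 <= tq], the budget of one output is at most
   [tp + 15 * #|T| * tq + 14 * #|T| * tu]; 20 rounds this up. *)
exists 20 => T e s t pi choose tp tq tu e_sym e_irr _ pi_path choose_path.
move=> _ tq_gt0 tu_gt0.
have sA : size [:: s] + #|to_target e t ([set: T] :\ s)| <= #|T|.
  rewrite add1n (cardD1 s T) ltnS; apply: subset_leq_card.
  apply/subsetP=> w; rewrite !inE => /and3P[+ _ _].
  by rewrite !inE !andbT.
have [exrun runP] := list_runP e_sym e_irr choose_path tp tq tu_gt0 pi_path sA.
split=> // H' out c /runP[_ out_uniq out_cont cost].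
have T_gt0 : 0 < #|T| by apply/card_gt0P; exists s.
have out_gt0 : 0 < size out.
  by move: cost T_gt0; case: (size out) => //; rewrite mul0n; clear; lia.
have outP : size out <= num_chordless e s t.
  rewrite /num_chordless cardE -(size_map val).
  apply: uniq_leq_size => // p /out_cont[q /= -> [pth lst unq chd _]].
  have szq : size (s :: q) <= #|T| by rewrite -(card_uniqP unq) max_card.
  apply/mapP; exists (Bseq szq) => //.
  rewrite mem_enum inE chd andbT; apply/and5P; split=> //; first exact/eqP.
  by apply/allP=> w _; rewrite /= inE.
move: cost; rewrite /setup_cost /potential.
set A := to_target _ _ _ in sA *.
have NT : #|nbrs e [set: T] s| <= #|T| by apply: max_card.
have AT : #|A| <= #|T| by apply: max_card.
have BT : #|A :\: nbrs e [set: T] s| <= #|T| by apply: max_card.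
set W := 1 + _ + _ + _; set m := #|edge_set e|.
have WY : W <= 20 * (tp + #|T| * tq + #|T| * tu).
  rewrite /W; move: NT AT BT T_gt0 tq_gt0.
  move: #|nbrs _ _ _| #|A| #|A :\: _| #|T|; clear=> N a b n Nn an bn n0 tq0.
  have := leq_mul (leqnn (9 + tq + 4 * tu)) an.
  have := leq_mul (leqnn (5 * tu)) (leq_add an bn).
  have := leq_pmulr n tq0; lia.
move=> /leq_trans/(_ (leq_mul outP WY)).
rewrite mulnCA (mulnDr 20).
(* The two [#|T|] of the setup are absorbed by the [tp + #|T| + #|T|] still on the left of the cost
   bound. *)
by move: #|T| (20 * (num_chordless e s t * _)); clear; lia.
Qed.
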